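(* Let $(V,\Omega)$ be a $6$-dimensional real symplectic vector space and let $\omega\in\Lambda^3(V^* )$ be an effective $3$-form, i.e. $\omega\wedge\Omega=0$. Then the Lychagin-Roubtsov quadratic form $q_\omega$ and the Hitchin endomorphism $K_\omega$ satisfy $$ q_\omega(X)=\Omega(K_\omega X,X) $$ for all $X\in V$.
   Context: Operator $\bot$: let $\Gamma:V\to V^*$ be the isomorphism determined by $\Omega$, and let $X_\Omega\in\Lambda^2(V)$ be the unique bivector such that $\Gamma^*(X_\Omega)=\Omega$. Then $\bot:\Lambda^k(V^* )\to\Lambda^{k-2}(V^* )$ is $\bot\omega=i_{X_\Omega}(\omega)$. With $\top\omega=\omega\wedge\Omega$ it satisfies $[\bot,\top](\omega)=(3-k)\omega$ for $\omega\in\Lambda^k(V^* )$. Lychagin-Roubtsov invariant: the quadratic form $q_\omega\in S^2(V^* )$ is defined by $q_\omega(X)=-\frac14\bot^2(i_X\omega\wedge i_X\omega)$. Hitchin invariant: fix the volume form $\theta=-\frac16\Omega^3$ and let $A:\Lambda^5(V^* )\to V\otimes\Lambda^6(V^* )$ be the isomorphism induced by the exterior product. The linear map $K_\omega:V\to V$ is defined by $K_\omega(X)\,\theta=A(i_X\omega\wedge\omega)$. *)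

(* Defs.v *)
From HB Require Import structures.
From mathcomp Require Import all_boot all_order all_algebra all_fingroup.
From mathcomp Require Import all_classical all_reals.

Set Implicit Arguments.
Unset Strict Implicit.
Unset Printing Implicit Defensive.

Import Order.TTheory GRing.Theory Num.Theory.
Local Open Scope ring_scope.

(* Exterior forms are alternating multilinear maps. The normalization is that
   of Kobayashi-Nomizu:
     a `wedge` b = Alt (a (x) b),  where Alt is the projection
                   (Alt t) v = 1/n! \sum_s sgn(s) t (v o s);
     (i_X w)(v_1, .., v_k) = (k + 1) w(X, v_1, .., v_k)  for w of degree k + 1.
   The factor k + 1 makes i_X an antiderivation of the wedge product, as
   required by [bot, top] w = (3 - k) w. With the determinant normalization
   (no factor in i_X) the exterior algebra, i_X, bot, q and K are the same up to
   isomorphism, but the value Om(X, Y) is doubled: q(X) = Om(K X, X) with the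
   coefficient -1/4 in q is an identity for the normalization used here. *)

Section Forms.
Variable R : realType.
Implicit Types V : lmodType R.

Definition set_tnth V k (v : k.-tuple V) (i : 'I_k) (x : V) : k.-tuple V :=
  [tuple if j == i then x else tnth v j | j < k].

Definition multilinear V k (f : k.-tuple V -> R^o) : Prop :=
  forall (v : k.-tuple V) (i : 'I_k) (a : R) (x y : V),
    f (set_tnth v i (a *: x + y)) = a * f (set_tnth v i x) + f (set_tnth v i y).

Definition alternating V k (f : k.-tuple V -> R^o) : Prop :=
  forall (v : k.-tuple V) (i j : 'I_k),
    i != j -> tnth v i = tnth v j -> f v = 0.

Definition is_form V k : {pred k.-tuple V -> R^o} :=
  fun f => `[< multilinear f /\ alternating f >].

Lemma is_form_submod V k : submod_closed (@is_form V k).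
Proof.
split=> [|a f g /asboolP[fm fa] /asboolP[gm ga]]; apply/asboolP; split.
- by move=> v i a x y; rewrite mulr0 addr0.
- by [].
- move=> v i b x y.
  rewrite /GRing.scale /= /GRing.add /= fm gm /GRing.scale /=.
  by rewrite !mulrDr !mulrA [a * b]mulrC addrACA.
- move=> v i j ij vij.
  by rewrite /GRing.scale /= /GRing.add /= (fa v i j) // (ga v i j) //
             scaler0 addr0.
Qed.

HB.instance Definition _ V k :=
  GRing.isSubmodClosed.Build R (k.-tuple V -> R^o) (@is_form V k)
    (is_form_submod V k).

Record eform V k := Form {
  form_fun :> k.-tuple V -> R^o;
  _ : form_fun \in @is_form V k }.

HB.instance Definition _ V k := [isSub for @form_fun V k].
HB.instance Definition _ V k := [Choice of eform V k by <:].
HB.instance Definition _ V k := [SubChoice_isSubLmodule of eform V k by <:].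

Lemma form_multilinear V k (w : eform V k) : multilinear w.
Proof. by case: w => f ff; have /asboolP[] := ff. Qed.

Lemma form_alternating V k (w : eform V k) : alternating w.
Proof. by case: w => f ff; have /asboolP[] := ff. Qed.

Lemma formP V k (w w' : eform V k) : (forall v, w v = w' v) -> w = w'.
Proof. by move=> ww'; apply/val_inj/funext. Qed.

Lemma form0E V k (v : k.-tuple V) : (0 : eform V k) v = 0.
Proof. by []. Qed.

Lemma formDE V k (a b : eform V k) v : (a + b) v = a v + b v.
Proof. by []. Qed.

Lemma formZE V k c (a : eform V k) v : (c *: a) v = c * a v.
Proof. by []. Qed.

Lemma form_sumE V k I (r : seq I) (P : pred I) (F : I -> eform V k) v :
  (\sum_(i <- r | P i) F i) v = \sum_(i <- r | P i) F i v.
Proof.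
apply: (big_morph (fun a : eform V k => a v : R)) => [a b|].
  exact: formDE.
exact: form0E.
Qed.

Definition perm_tuple V k (v : k.-tuple V) (s : 'S_k) : k.-tuple V :=
  [tuple tnth v (s i) | i < k].

Definition alt V k (t : k.-tuple V -> R^o) : k.-tuple V -> R^o :=
  fun v => k`!%:R^-1 * \sum_(s : 'S_k) (-1) ^+ s * t (perm_tuple v s).

Lemma perm_set_tnth V k (v : k.-tuple V) i x (s : 'S_k) :
  perm_tuple (set_tnth v i x) s = set_tnth (perm_tuple v s) (s^-1%g i) x.
Proof.
apply: eq_from_tnth => j; rewrite !tnth_mktuple.
by rewrite -[j == _](inj_eq (@perm_inj _ s)) permKV.
Qed.

Lemma alt_is_form V k (t : k.-tuple V -> R^o) :
  multilinear t -> alt t \in @is_form V k.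
Proof.
move=> tm; apply/asboolP; split.
  move=> v i a x y; rewrite /alt mulrCA -mulrDr; congr (_ * _).
  rewrite mulr_sumr -big_split /=; apply: eq_bigr => s _.
  by rewrite !perm_set_tnth tm mulrDr mulrCA.
move=> v i j ij vij; rewrite /alt.
pose f (s : 'S_k) : R := (-1) ^+ s * t (perm_tuple v s).
suff -> : \sum_(s : 'S_k) f s = 0 by rewrite mulr0.
suff S0 : \sum_(s : 'S_k) f s = - \sum_(s : 'S_k) f s.
  by apply/eqP; rewrite -[_ == 0](@mulrn_eq0 R _ 2) mulr2n {1}S0 addNr.
rewrite -sumrN [LHS](reindex_inj (mulIg (tperm i j))) /=.
apply: eq_bigr => s _; rewrite /f odd_permM odd_tperm ij addbT signrN mulNr.
congr (- (_ * t _)); apply: eq_from_tnth => l.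
rewrite !tnth_mktuple permM.
by case: tpermP => [->|->|].
Qed.

Definition ltuple V k l (v : (k + l).-tuple V) : k.-tuple V :=
  [tuple tnth v (lshift l i) | i < k].
Definition rtuple V k l (v : (k + l).-tuple V) : l.-tuple V :=
  [tuple tnth v (rshift k i) | i < l].

Definition tens V k l (a : eform V k) (b : eform V l) : (k + l).-tuple V -> R^o :=
  fun v => a (ltuple v) * b (rtuple v).

Lemma tens_multilinear V k l (a : eform V k) (b : eform V l) :
  multilinear (tens a b).
Proof.
move=> v i c x y; rewrite /tens.
case: (split_ordP i) => j ->.
- have lE z : ltuple (set_tnth v (lshift l j) z) = set_tnth (ltuple v) j z.
    by apply: eq_from_tnth => m; rewrite !tnth_mktuple eq_lshift.
  have rE z : rtuple (set_tnth v (lshift l j) z) = rtuple v.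
    by apply: eq_from_tnth => m; rewrite !tnth_mktuple eq_rlshift.
  by rewrite !lE !rE form_multilinear mulrDl mulrA.
- have lE z : ltuple (set_tnth v (rshift k j) z) = ltuple v.
    by apply: eq_from_tnth => m; rewrite !tnth_mktuple eq_lrshift.
  have rE z : rtuple (set_tnth v (rshift k j) z) = set_tnth (rtuple v) j z.
    by apply: eq_from_tnth => m; rewrite !tnth_mktuple eq_rshift.
  by rewrite !lE !rE form_multilinear mulrDr mulrCA.
Qed.

Definition wedge V k l (a : eform V k) (b : eform V l) : eform V (k + l) :=
  Form (alt_is_form (tens_multilinear a b)).

Definition iprod_fun V k (X : V) (w : eform V k.+1) : k.-tuple V -> R^o :=
  fun v => k.+1%:R * w [tuple of X :: v].

Lemma iprod_is_form V k (X : V) (w : eform V k.+1) :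
  iprod_fun X w \in @is_form V k.
Proof.
have consE v (i : 'I_k) z :
    [tuple of X :: set_tnth v i z] = set_tnth [tuple of X :: v] (lift ord0 i) z.
  apply: eq_from_tnth => j; rewrite tnth_mktuple.
  case: (unliftP ord0 j) => [m|] ->; last by rewrite !tnth0.
  by rewrite !tnthS tnth_mktuple (inj_eq lift_inj).
apply/asboolP; split=> [v i a x y|v i j ij vij]; rewrite /iprod_fun.
  by rewrite !consE form_multilinear mulrDr mulrCA.
rewrite (@form_alternating _ _ w _ (lift ord0 i) (lift ord0 j)) ?mulr0 //.
by rewrite !tnthS.
Qed.

Definition iprod V k (X : V) (w : eform V k.+1) : eform V k :=
  Form (iprod_is_form X w).

Lemma iprodPl V k a (X Y : V) (w : eform V k.+1) :
  iprod (a *: X + Y) w = a *: iprod X w + iprod Y w.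
Proof.
apply: formP => v; rewrite formDE formZE /= /iprod_fun.
have E z : [tuple of z :: v] = set_tnth [tuple of 0 :: v] ord0 z.
  apply: eq_from_tnth => j; rewrite tnth_mktuple.
  by case: (unliftP ord0 j) => [m|] -> //; rewrite !tnthS.
by rewrite (E (_ + _)) form_multilinear -!E mulrDr mulrCA.
Qed.

Lemma iprodPr V k a (X : V) (w w' : eform V k.+1) :
  iprod X (a *: w + w') = a *: iprod X w + iprod X w'.
Proof.
apply: formP => v; rewrite formDE formZE /= /iprod_fun formDE formZE.
by rewrite mulrDr mulrCA.
Qed.

Lemma iprod_suml V k I (r : seq I) (c : I -> R) (e : I -> V) (w : eform V k.+1) :
  iprod (\sum_(i <- r) c i *: e i) w = \sum_(i <- r) c i *: iprod (e i) w.
Proof.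
elim: r => [|i r IHr]; last by rewrite !big_cons iprodPl IHr.
rewrite !big_nil; apply: (addrI (iprod 0 w)).
by have := iprodPl 1 0 0 w; rewrite !scale1r !addr0.
Qed.

Lemma iprod_sumr V k I (r : seq I) (c : I -> R) (X : V) (w : I -> eform V k.+1) :
  iprod X (\sum_(i <- r) c i *: w i) = \sum_(i <- r) c i *: iprod X (w i).
Proof.
elim: r => [|i r IHr]; last by rewrite !big_cons iprodPr IHr.
rewrite !big_nil; apply: (addrI (iprod X 0)).
by have := iprodPr 1 X 0 (0 : eform V k.+1); rewrite !scale1r !addr0.
Qed.

Lemma iprodK V k (X : V) (w : eform V k.+2) : iprod X (iprod X w) = 0.
Proof.
apply: formP => v; rewrite form0E /= /iprod_fun /= /iprod_fun.
rewrite (@form_alternating _ _ w _ ord0 (lift ord0 ord0)) ?mulr0 //.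
Qed.

Lemma iprodC V k (X Y : V) (w : eform V k.+2) :
  iprod X (iprod Y w) = - iprod Y (iprod X w).
Proof.
have := iprodK (1 *: X + Y) w.
rewrite !iprodPl -[iprod X w]scale1r !iprodPr !scale1r !iprodK add0r addr0.
by rewrite addrC => /eqP; rewrite addr_eq0 => /eqP ->; rewrite ?opprK.
Qed.

(* The dual space V^* is [eform V 1]. A vector is a 1-form on V^*, so that
   Lambda^2 V is [eform (eform V 1) 2]. *)
Lemma vec1_is_form V (X : V) :
  (fun v : 1.-tuple (eform V 1) => tnth v ord0 [tuple X]) \in is_form (k := 1).
Proof.
apply/asboolP; split=> [v i a x y|v i j]; last by rewrite !ord1.
by rewrite !tnth_mktuple (ord1 i).
Qed.

Definition vec1 V (X : V) : eform (eform V 1) 1 := Form (vec1_is_form X).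

Lemma wedge11 V (a b : eform V 1) x y :
  wedge a b [tuple x; y] =
  2^-1 * (a [tuple x] * b [tuple y] - a [tuple y] * b [tuple x]).
Proof.
pose v := [tuple x; y].
pose M := \matrix_(i < 2, j < 2)
  (if i == ord0 then a [tuple tnth v j] else b [tuple tnth v j]).
have -> : wedge a b v = 2^-1 * \det M.
  rewrite /= /alt; congr (_ * _); apply: eq_bigr => s _; congr (_ * _).
  rewrite big_ord_recl big_ord1 !mxE /= /tens.
  congr (a _ * b _); apply: eq_from_tnth => i; rewrite !tnth_mktuple !ord1 tnth0;
    by congr (tnth _ (s _)); apply/val_inj.
rewrite (expand_det_row _ ord0) big_ord_recl big_ord1 /cofactor !det_mx11 !mxE /=.
by congr (_ * _); rewrite expr0 expr1 mul1r mulN1r mulrN.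
Qed.

Definition pullback_tuple V W (f : V -> W) k (v : k.-tuple V) : k.-tuple W :=
  [tuple of map f v].

End Forms.

Section Symplectic.
Variables (R : realType) (V : vectType R).

Definition symplectic (Om : eform V 2) : Prop :=
  forall X : V, (forall Y : V, Om [tuple X; Y] = 0) -> X = 0.

Lemma dualb_is_form (i : 'I_(\dim {:V})) :
  (fun v : 1.-tuple V => coord (vbasis {:V}) i (tnth v ord0) : R^o)
    \in is_form (k := 1).
Proof.
apply/asboolP; split=> [v j a x y|v j l]; last by rewrite !ord1.
by rewrite !tnth_mktuple (ord1 j) eqxx linearP.
Qed.

Definition dualb (i : 'I_(\dim {:V})) : eform V 1 := Form (dualb_is_form i).

(* With (e_i) a basis and (e^i) its dual basis, a bivector is
   B = \sum_(i, j) B(e^i, e^j) e_i `wedge` e_j, and i_(X `wedge` Y) = i_Y i_X;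
   see [contract_wedge]. *)
Definition contract k (B : eform (eform V 1) 2) (w : eform V k.+2) : eform V k :=
  \sum_i \sum_j B [tuple dualb i; dualb j] *:
    iprod (vbasis {:V})`_j (iprod (vbasis {:V})`_i w).

Lemma contract_wedge k (X Y : V) (w : eform V k.+2) :
  contract (wedge (vec1 X) (vec1 Y)) w = iprod Y (iprod X w).
Proof.
pose e := vbasis {:V}.
have XE (Z : V) : Z = \sum_i coord e i Z *: e`_i by exact/coord_vbasis/memvf.
pose S := \sum_i \sum_j (coord e i X * coord e j Y) *: iprod e`_j (iprod e`_i w).
have -> : iprod Y (iprod X w) = S.
  rewrite {1}(XE X) iprod_suml iprod_sumr /S; apply: eq_bigr => i _.
  rewrite {1}(XE Y) iprod_suml scaler_sumr; apply: eq_bigr => j _.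
  by rewrite scalerA.
transitivity (2^-1 *: (S + S)); last first.
  by rewrite -mulr2n -scaler_nat scalerA mulVf ?scale1r // pnatr_eq0.
rewrite {2}/S exchange_big /= /S -big_split scaler_sumr; apply: eq_bigr => i _.
rewrite -big_split scaler_sumr; apply: eq_bigr => j _.
have -> : iprod e`_i (iprod e`_j w) = - iprod e`_j (iprod e`_i w).
  exact: iprodC.
set u := iprod e`_j _; pose c l m := coord e l X * coord e m Y.
rewrite scalerN; transitivity (2^-1 *: (c i j *: u - c j i *: u)) => //.
by rewrite -scalerBl scalerA wedge11; congr ((_ * (_ - _)) *: _).
Qed.

Definition Gamma (Om : eform V 2) (X : V) : eform V 1 := iprod X Om.

(* X_Om : the bivector whose pullback along Gamma : V -> V^* is Om. *)
Definition XOmega (Om : eform V 2) : eform (eform V 1) 2 :=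
  xget 0 [set B : eform (eform V 1) 2 |
    forall v : 2.-tuple V, B (pullback_tuple (Gamma Om) v) = Om v]%classic.

Definition bot (Om : eform V 2) k (w : eform V k.+2) : eform V k :=
  contract (XOmega Om) w.

Definition lr_form (Om : eform V 2) (w : eform V 3) (X : V) : R :=
  - 4^-1 * (bot Om (bot Om (wedge (iprod X w) (iprod X w) : eform V 4))) [tuple].

Definition theta (Om : eform V 2) : eform V 6 :=
  - 6^-1 *: wedge (wedge Om Om) Om.

(* V (x) Lambda^6 V^* is identified with the linear maps V^* -> Lambda^6 V^*:
   Y (x) t is a |-> a(Y) t, and A(phi) is a |-> a `wedge` phi. *)
Definition vtens (Y : V) (t : eform V 6) : eform V 1 -> eform V 6 :=
  fun a => a [tuple Y] *: t.

Definition hitchin_A (phi : eform V 5) : eform V 1 -> eform V 6 :=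
  fun a => wedge a phi.

Definition hitchin (Om : eform V 2) (w : eform V 3) : 'End(V) :=
  xget 0 [set K : 'End(V) |
    forall X : V, vtens (K X) (theta Om) = hitchin_A (wedge (iprod X w) w)]%classic.

End Symplectic.

(* Main.v *)
Require Import Defs.
From HB Require Import structures.
From mathcomp Require Import all_boot all_order all_algebra all_fingroup.
From mathcomp Require Import all_classical all_reals.
From mathcomp Require Import ring lra.

Set Implicit Arguments.
Unset Strict Implicit.
Unset Printing Implicit Defensive.

Import Order.TTheory GRing.Theory Num.Theory.
Local Open Scope ring_scope.

(** Write [T u = Om /\ u], [a = i_X w], and let [K] be the Hitchin endomorphism.
   The 7-form [Om /\ (a /\ w)] vanishes, and contracting it with [X] gives
   [i_X Om /\ (a /\ w) = - T (a /\ a)]; by definition of [K] the left-hand side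
   is [(i_X Om)(K X) theta]. It remains to compare [T s] with the volume form for
   a 4-form [s]. The commutation [bot T - T bot = 3 - k] on k-forms, together
   with [T t = 0] for every 6-form [t], yields [12 T s = (bot^2 s) Om^3]. Hence
   [(i_X Om)(K X) = bot^2 (a /\ a) / 2], and [(i_X Om)(Y) = 2 Om(X, Y)].

   The commutation relation follows from the antiderivation property of [i_X]
   once [bot] is written as [1/2 \sum_j i_(e_j) i_(f_j)], where [(e_j)] is a
   basis and [Gamma f_j] is the dual basis [e^j]. *)

(** * Sign rule and antiderivation property *)

Section SignRule.
Variables (R : realType) (V : lmodType R).

Lemma multilinearD k (f : k.-tuple V -> R^o) v i x y : multilinear f ->
  f (set_tnth v i (x + y)) = f (set_tnth v i x) + f (set_tnth v i y).
Proof. by move=> fm; rewrite -[x in LHS]scale1r fm mul1r. Qed.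

(** Polarization: [w] vanishes with [x + y] in both slots [i] and [j], and expanding leaves the two
    mixed values, whose sum is therefore 0. *)
Lemma form_tperm k (w : eform V k) v (i j : 'I_k) : i != j ->
  w (perm_tuple v (tperm i j)) = - w v.
Proof.
move=> ij; have wm := form_multilinear w; have wa := form_alternating w.
pose u x y := set_tnth (set_tnth v i x) j y.
have uE x y m : tnth (u x y) m =
    if m == j then y else if m == i then x else tnth v m.
  by rewrite !tnth_mktuple.
(* Multilinearity expands only the outermost slot, so the two slots have to be interchangeable. *)
have uC x y : u x y = set_tnth (set_tnth v j y) i x.
  apply: eq_from_tnth => m; rewrite uE !tnth_mktuple.
  by case: eqVneq => [->|//]; rewrite eq_sym (negPf ij).
have u0 x : w (u x x) = 0.
  by apply: (wa _ i j ij); rewrite !uE eqxx (negPf ij) eqxx.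
have -> : v = u (tnth v i) (tnth v j).
  by apply: eq_from_tnth => m; rewrite uE; do 2![case: eqVneq => [->|_] //].
have -> : perm_tuple (u (tnth v i) (tnth v j)) (tperm i j) =
    u (tnth v j) (tnth v i).
  apply: eq_from_tnth => m; rewrite tnth_mktuple !uE.
  case: tpermP => [->|->|/eqP mi /eqP mj]; last first.
    by rewrite (negPf mi) (negPf mj).
    by rewrite eqxx (negPf ij) eqxx.
  by rewrite eqxx [i == j](negPf ij) eqxx.
have := u0 (tnth v i + tnth v j).
rewrite {1}/u multilinearD // -!/(u _ _) !uC.
rewrite !multilinearD // -!uC !u0 add0r addr0.
by move=> /eqP; rewrite addr_eq0 => /eqP.
Qed.

Lemma perm_tupleM k (v : k.-tuple V) (s t : 'S_k) :
  perm_tuple v (s * t)%g = perm_tuple (perm_tuple v t) s.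
Proof. by apply: eq_from_tnth => i; rewrite !tnth_mktuple permM. Qed.

Lemma form_perm k (w : eform V k) v (s : 'S_k) :
  w (perm_tuple v s) = (-1) ^+ s * w v.
Proof.
have [ts -> dts] := prod_tpermP s; elim: ts dts v => [|[i j] ts IH] /= dts v.
  rewrite big_nil odd_perm1 mul1r; congr (w _).
  by apply: eq_from_tnth => i; rewrite tnth_mktuple perm1.
case/andP: dts => /= ij dts; rewrite big_cons perm_tupleM form_tperm // IH //.
by rewrite odd_permM odd_tperm ij /= signrN mulNr.
Qed.

(** * Expansion of an alternation along one argument *)

Definition tinsert n (i : 'I_n.+1) (X : V) (u : n.-tuple V) : n.+1.-tuple V :=
  [tuple oapp (tnth u) X (unlift i j) | j < n.+1].

Lemma tinsert_perm n (i : 'I_n.+1) X (u : n.-tuple V) (s : 'S_n) :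
  tinsert i X (perm_tuple u s) =
  perm_tuple [tuple of X :: u] (lift_perm i ord0 s).
Proof.
apply: eq_from_tnth => j; rewrite !tnth_mktuple; case: unliftP => [m|] -> /=.
  by rewrite lift_perm_lift tnthS tnth_mktuple.
by rewrite lift_perm_id.
Qed.

Lemma form_tinsert n (w : eform V n.+1) (i : 'I_n.+1) X u :
  w (tinsert i X u) = (-1) ^+ i * w [tuple of X :: u].
Proof.
have {1}-> : u = perm_tuple u 1.
  by apply: eq_from_tnth => j; rewrite tnth_mktuple perm1.
by rewrite tinsert_perm form_perm odd_lift_perm odd_perm1 !addbF signr_odd.
Qed.

(** A permutation amounts to the preimage [i] of 0 together with the bijection it induces on the
    other points; injectivity suffices because [(n+1)! = (n+1) n!]. *)
Lemma lift_perm0_bij n :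
  bijective (fun p : 'I_n.+1 * 'S_n => lift_perm p.1 ord0 p.2).
Proof.
apply: inj_card_bij; last first.
  by rewrite card_prod !card_Sn card_ord factS.
move=> [i s] [j t] /= /permP E; have ij : i = j.
  by apply: (@perm_inj _ (lift_perm j ord0 t)); rewrite -E !lift_perm_id.
subst j; congr pair; apply/permP => m.
by have := E (lift i m); rewrite !lift_perm_lift => /lift_inj.
Qed.

(** The permutations are grouped by the slot [i] in which [X] lands; the factor [n + 1] turns
    [1/(n+1)!] into [1/n!]. *)
Lemma alt_cons n (t : n.+1.-tuple V -> R^o) X (v : n.-tuple V) :
  n.+1%:R * alt t [tuple of X :: v] =
  \sum_(i < n.+1) (-1) ^+ i * alt (fun u => t (tinsert i X u)) v.
Proof.
rewrite /alt (reindex _ (onW_bij _ (lift_perm0_bij n))) /=.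
rewrite -(pair_bigA _ (fun i s => (-1) ^+ lift_perm i ord0 s *
  t (perm_tuple [tuple of X :: v] (lift_perm i ord0 s)))) /=.
rewrite mulrA factS natrM invfM mulrA mulfV ?mul1r ?pnatr_eq0 //.
rewrite mulr_sumr; apply: eq_bigr => i _; rewrite mulrCA; congr (_ * _).
rewrite mulr_sumr; apply: eq_bigr => s _.
by rewrite odd_lift_perm addbF signr_addb signr_odd mulrA tinsert_perm.
Qed.

Lemma alt_tcast m n (e : m = n) (t : n.-tuple V -> R^o) v :
  alt t (tcast e v) = alt (fun u => t (tcast e u)) v.
Proof. by case: n / e t. Qed.

Lemma altZ k c (t t' : k.-tuple V -> R^o) v :
  (forall u, t u = c * t' u) -> alt t v = c * alt t' v.
Proof.
move=> tt'; rewrite /alt [RHS]mulrCA; congr (_ * _); rewrite mulr_sumr.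
by apply: eq_bigr => s _; rewrite tt' mulrCA.
Qed.

Lemma altD k (t t1 t2 : k.-tuple V -> R^o) v :
  (forall u, t u = t1 u + t2 u) -> alt t v = alt t1 v + alt t2 v.
Proof.
move=> tE; rewrite /alt -mulrDr -big_split; congr (_ * _).
by apply: eq_bigr => s _; rewrite tE mulrDr.
Qed.

Lemma wedgeE k l (a : eform V k) (b : eform V l) v :
  wedge a b v = alt (tens a b) v.
Proof. by []. Qed.

Lemma iprodE k X (w : eform V k.+1) v :
  iprod X w v = k.+1%:R * w [tuple of X :: v].
Proof. by []. Qed.

Lemma sum_mean n (x : R) : \sum_(i < n.+1) n.+1%:R^-1 * x = x.
Proof. by rewrite sumr_const card_ord -[LHS]mulr_natl mulVKf ?pnatr_eq0. Qed.

(* The two summands have degrees [k + l.+1] and [k.+1 + l], which are not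
   convertible: they are evaluated at tuples with the same underlying sequence. *)
Lemma iprod_wedge k l X (a : eform V k.+1) (b : eform V l.+1) v v' :
  val v = val v' ->
  iprod X (wedge a b : eform V (k + l.+1).+1) v =
  wedge (iprod X a) b v + (-1) ^+ k.+1 * wedge a (iprod X b) v'.
Proof.
have scale_l n (s x y : R) :
    s * x * y = s * n.+1%:R^-1 * (n.+1%:R * x * y).
  by rewrite -!mulrA mulKf ?pnatr_eq0.
have scale_r n (s x y : R) :
    x * (s * y) = s * n.+1%:R^-1 * (x * (n.+1%:R * y)).
  by rewrite -[RHS]mulrA [x * (n.+1%:R * y)]mulrCA mulKf ?pnatr_eq0 // mulrCA.
have sign_cancel m i (c y : R) :
    (-1) ^+ (m + i) * ((-1) ^+ i * c * y) = c * ((-1) ^+ m * y).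
  by rewrite exprD -!mulrA signrMK mulrCA.
move=> vv'; pose e : (k + l.+1 = k.+1 + l)%N := esym (addSnnS k l).
have {vv'} -> : v' = tcast e v by apply: val_inj; rewrite /= val_tcast.
rewrite iprodE (alt_cons (n := (k + l.+1)%N)).

(* The first [k + 1] slots feed [X] to [a], the other [l + 1] to [b]. All summands of a block are
   equal, so each is the block's total divided by its size. *)
rewrite (@big_split_ord _ _ _ k.+1 l.+1) /=; congr (_ + _).
  rewrite (eq_bigr (fun=> k.+1%:R^-1 * (wedge (iprod X a) b v : R))) => [|i _].
    exact: sum_mean.
  (* Bringing [X] to the front of [a] costs [(-1)^i], cancelling the sign in [alt_cons]; the inverse
     of [k + 1] offsets the factor in [iprod]. *)
  pose c : R := (-1) ^+ i * k.+1%:R^-1.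
  rewrite (altZ (c := c) (t' := tens (iprod X a) b)).
    by rewrite /c !mulrA -exprD addnn -mul2n exprM sqrrN !expr1n mul1r.
  move=> u; rewrite /tens iprodE.
  have -> : ltuple (tinsert (lshift l.+1 i) X u : (k.+1 + l.+1).-tuple V) =
      tinsert i X (ltuple u).
    apply: eq_from_tnth => j; rewrite !tnth_mktuple.
    case: (unliftP i j) => [m|] -> /=.
      have -> : lshift l.+1 (lift i m) =
          lift (lshift l.+1 i) (lshift l.+1 m : 'I_(k + l.+1)).
        by apply: val_inj.
      by rewrite liftK /= tnth_mktuple.
    by rewrite unlift_none.
  have -> : rtuple (tinsert (lshift l.+1 i) X u : (k.+1 + l.+1).-tuple V) =
      rtuple u.
    apply: eq_from_tnth => j; rewrite !tnth_mktuple.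
    have -> : rshift k.+1 j = lift (lshift l.+1 i) (rshift k j : 'I_(k + l.+1)).
      by apply: val_inj; rewrite /= /bump (leq_trans _ (leq_addr _ _)) // -ltnS.
    by rewrite liftK.
  rewrite form_tinsert /c; exact: scale_l.
rewrite (eq_bigr (fun=> l.+1%:R^-1 *
    ((-1) ^+ k.+1 * (wedge a (iprod X b) (tcast e v) : R)))) => [|i _].
  exact: sum_mean.
(* Here the slot is [k + 1 + i], so the sign [(-1)^(k+1)] survives. *)
pose c : R := (-1) ^+ i * l.+1%:R^-1.
rewrite wedgeE alt_tcast.
rewrite (altZ (c := c) (t' := fun u => tens a (iprod X b) (tcast e u))).
  exact: sign_cancel.
move=> u; rewrite /tens iprodE.
have -> : ltuple (tinsert (rshift k.+1 i) X u : (k.+1 + l.+1).-tuple V) =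
    ltuple (tcast e u).
  apply: eq_from_tnth => j; rewrite !tnth_mktuple tcastE.
  have -> : lshift l.+1 j =
      lift (rshift k.+1 i) (cast_ord (esym e) (lshift l j) : 'I_(k + l.+1)).
    by apply: val_inj => /=; rewrite /bump leqNgt ltn_addr.
  by rewrite liftK.
have -> : rtuple (tinsert (rshift k.+1 i) X u : (k.+1 + l.+1).-tuple V) =
    tinsert i X (rtuple (tcast e u)).
  apply: eq_from_tnth => j; rewrite !tnth_mktuple.
  case: (unliftP i j) => [m|] -> /=; last by rewrite unlift_none.
  rewrite tnth_mktuple tcastE.
  have -> : rshift k.+1 (lift i m) =
      lift (rshift k.+1 i) (cast_ord (esym e) (rshift k.+1 m) : 'I_(k + l.+1)).
    by apply: val_inj => /=; rewrite /bump leq_add2l addnCA.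
  by rewrite liftK.
rewrite form_tinsert /c; exact: scale_r.
Qed.

End SignRule.

Arguments form_fun : simpl never.

(** * Exterior algebra *)

Section Wedge.
Variables (R : realType) (V : lmodType R).

(** Allows induction on the degree: identities of forms are checked after one contraction. *)
Lemma form_iprod_inj k (w w' : eform V k.+1) :
  (forall X, iprod X w = iprod X w') -> w = w'.
Proof.
move=> ww'; apply: formP => v; rewrite [v]tuple_eta.
have kn0 : k.+1%:R != 0 :> R by rewrite pnatr_eq0.
apply: (mulfI kn0).
have : iprod (thead v) w (behead_tuple v) = iprod (thead v) w' (behead_tuple v).
  by rewrite ww'.
by [].
Qed.

Lemma alt_form k (w : eform V k) v : alt w v = w v.
Proof.
have E (s : 'S_k) : (-1) ^+ s * w (perm_tuple v s) = w v :> R.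
  by rewrite form_perm mulrA -signr_addb addbb mul1r.
rewrite /alt (eq_bigr (fun=> w v : R)) => [|s _]; last exact: E.
have card_k : #|'S_k| = k`! by rewrite card_Sn.
rewrite sumr_const card_k.
have mean (x : R) : k`!%:R^-1 * (x *+ k`!) = x.
  by rewrite -[x *+ _]mulr_natl mulKf // pnatr_eq0 -lt0n fact_gt0.
exact: mean.
Qed.

Lemma wedge0l k (c : eform V 0) (u : eform V k) :
  wedge c u = c [tuple] *: u :> eform V k.
Proof.
apply: formP => v; rewrite formZE -(alt_form u) wedgeE.
apply: altZ => t; rewrite /tens [ltuple _]tuple0.
by congr (_ * u _); apply: eq_from_tnth => i; rewrite tnth_mktuple;
  congr tnth; apply: val_inj.
Qed.

(** The degrees [k + 0] and [k] are not convertible, hence two tuples with the same underlying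
    sequence. *)
Lemma wedge0r k (u : eform V k) (c : eform V 0) v v' :
  val v = val v' -> wedge u c v = c [tuple] * u v'.
Proof.
move=> vv'; have -> : v' = tcast (addn0 k) v.
  by apply: val_inj; rewrite /= val_tcast.
rewrite wedgeE -(alt_form u) alt_tcast; apply: altZ => t.
rewrite /tens [rtuple _]tuple0 mulrC; congr (_ * u _).
by apply: eq_from_tnth => i; rewrite tnth_mktuple tcastE;
  congr tnth; apply: val_inj.
Qed.

Lemma wedgePl k l x (a a' : eform V k) (b : eform V l) :
  wedge (x *: a + a') b = x *: wedge a b + wedge a' b.
Proof.
apply: formP => v; rewrite formDE formZE !wedgeE.
rewrite (altD (t1 := tens (x *: a) b) (t2 := tens a' b)) => [|u].
  by congr (_ + _); apply: altZ => u; rewrite /tens formZE mulrA.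
by rewrite /tens formDE mulrDl.
Qed.

Lemma wedgePr k l x (a : eform V k) (b b' : eform V l) :
  wedge a (x *: b + b') = x *: wedge a b + wedge a b'.
Proof.
apply: formP => v; rewrite formDE formZE !wedgeE.
rewrite (altD (t1 := tens a (x *: b)) (t2 := tens a b')) => [|u].
  by congr (_ + _); apply: altZ => u; rewrite /tens formZE mulrCA.
by rewrite /tens formDE mulrDr.
Qed.

Lemma wedge0f k l (b : eform V l) : wedge (0 : eform V k) b = 0.
Proof.
apply: (addrI (wedge (0 : eform V k) b)).
by have := wedgePl 1 (0 : eform V k) 0 b; rewrite !scale1r !addr0.
Qed.

Lemma wedge_suml k l I (r : seq I) (c : I -> R) (a : I -> eform V k)
    (b : eform V l) :
  wedge (\sum_(i <- r) c i *: a i) b = \sum_(i <- r) c i *: wedge (a i) b.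
Proof.
elim: r => [|i r IHr]; first by rewrite !big_nil wedge0f.
by rewrite !big_cons wedgePl IHr.
Qed.

Fact wedger_linear k l (a : eform V k) :
  linear (fun b : eform V l => wedge a b).
Proof. by move=> x b b'; rewrite wedgePr. Qed.

HB.instance Definition _ k l (a : eform V k) :=
  GRing.isLinear.Build R (eform V l) (eform V (k + l)) *:%R (@wedge R V k l a)
    (wedger_linear a).

Lemma wedgeDr k l (a : eform V k) (b b' : eform V l) :
  wedge a (b + b') = wedge a b + wedge a b'.
Proof. exact: linearD. Qed.

Lemma wedgeZr k l x (a : eform V k) (b : eform V l) :
  wedge a (x *: b) = x *: wedge a b.
Proof. exact: linearZ. Qed.

Fact iprod_linear k (X : V) : linear (@iprod R V k X).
Proof. by move=> x a a'; rewrite iprodPr. Qed.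

HB.instance Definition _ k (X : V) :=
  GRing.isLinear.Build R (eform V k.+1) (eform V k) *:%R (@iprod R V k X)
    (iprod_linear X).

Lemma iprod_wedge1 k X (a : eform V 1) (u : eform V k.+1) :
  iprod X (wedge a u : eform V k.+2) = a [tuple X] *: u - wedge a (iprod X u).
Proof.
apply: formP => v; rewrite (iprod_wedge X a u (v' := v)) // wedge0l formZE.
rewrite formDE formZE expr1 mulN1r; congr (_ * _ + _).
by rewrite iprodE mul1r; congr (a _); apply: val_inj.
Qed.

Lemma iprod_wedge2 k X (a : eform V 2) (u : eform V k.+1) :
  iprod X (wedge a u : eform V k.+3) =
  wedge (iprod X a) u + wedge a (iprod X u).
Proof.
apply: formP => v; rewrite (iprod_wedge X a u (v' := v)) //.
by rewrite sqrrN expr1n mul1r.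
Qed.

(** Sign bookkeeping for the inductive step of [wedgeC]: [x] and [y] are the terms in which [a],
    respectively [b], has been contracted. *)
Lemma sign_swap k l (x y : R) :
  (-1) ^+ (k * l.+1) * x + (-1) ^+ k.+1 * ((-1) ^+ (k.+1 * l) * y) =
  (-1) ^+ (k.+1 * l.+1) * (y + (-1) ^+ l.+1 * x).
Proof.
rewrite mulrDr addrC mulrA -exprD -mulnS; congr (_ + _).
by rewrite mulSn addnC exprD -mulrA signrMK.
Qed.

(* Both sides are compared after contraction with the first vector. *)
Lemma wedgeC k l (a : eform V k) (b : eform V l) v v' :
  val v = val v' -> wedge a b v = (-1) ^+ (k * l) * wedge b a v'.
Proof.
(* The outer hypothesis, kept general in [l], swaps the term with [a] contracted; the inner one
   swaps the term with [b] contracted. *)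
elim: k l a b v v' => [|k IHk] l a b v v' vv'.
  by rewrite wedge0l (wedge0r _ _ (v' := v)) // mul1r.
elim: l b v v' vv' => [|l IHl] b v v' vv'.
  by rewrite wedge0l (wedge0r _ _ (v' := v')) // muln0 mul1r.
pose X := thead v.
have vE : tval v = tval v' := vv'.
have EX : thead v' = X by rewrite /X /thead !(tnth_nth 0) vE.
pose u : (k + l.+1).-tuple V := behead_tuple v.
pose u' : (l + k.+1).-tuple V := behead_tuple v'.
have uu' : val u = val u' by rewrite /= vE.
pose u1 := tcast (esym (addSnnS k l)) u.
pose u1' := tcast (esym (addSnnS l k)) u'.
have nn0 : (k + l.+1).+1%:R != 0 :> R by rewrite pnatr_eq0.
apply: (mulfI nn0); rewrite [RHS]mulrCA.
have -> : v = [tuple of X :: u] := tuple_eta v.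
have -> : v' = [tuple of X :: u'] by rewrite -EX; apply: tuple_eta.
have nE : (l + k.+1).+1%:R = (k + l.+1).+1%:R :> R.
  by rewrite -addSnnS addnC.
have uu1 : val u = val u1 by rewrite /= val_tcast.
have uu1' : val u' = val u1' by rewrite /= val_tcast.
have := iprod_wedge X a b uu1; rewrite iprodE => ->.
have := iprod_wedge X b a uu1'; rewrite iprodE nE => ->.
rewrite (IHk l.+1 (iprod X a) b u u1') -?uu1' //.
rewrite (IHl (iprod X b) u1 u') -?uu1 //.
exact: sign_swap.
Qed.
End Wedge.

(** * Dual bases and the isomorphism Gamma *)

Section Duality.
Variables (R : realType) (V : vectType R).
Local Notation e := (vbasis {:V}).

Lemma form_basis0 k (w : eform V k) :
  (forall v : k.-tuple V, {subset v <= e} -> w v = 0) -> w = 0.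
Proof.
elim: k w => [|k IHk] w w0.
  by apply: formP => v; apply: w0 => x; rewrite tuple0.
apply: form_iprod_inj => X; rewrite linear0.
rewrite {1}(coord_vbasis (memvf X)) iprod_suml big1 // => i _.
rewrite (IHk (iprod _ w)) ?scaler0 // => v ve; rewrite iprodE w0 ?mulr0 // => x.
by rewrite inE => /predU1P[->|/ve //]; rewrite mem_nth // size_tuple.
Qed.

(** Pigeonhole: more than [\dim {:V}] basis vectors contain a repetition. *)
Lemma form_gt_dim0 k (w : eform V k) : (\dim {:V} < k)%N -> w = 0.
Proof.
move=> dimk; apply: form_basis0 => v ve.
have /(uniqPn 0)[i [j [ij jk vij]]] : ~~ uniq v.
  apply: contraL dimk => /uniq_leq_size/(_ ve).
  by rewrite !size_tuple -leqNgt.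
rewrite size_tuple in jk.
have wa := form_alternating w.
apply: (wa _ (Ordinal (ltn_trans ij jk)) (Ordinal jk)).
  by rewrite -val_eqE /= neq_ltn ij.
by rewrite !(tnth_nth 0).
Qed.

Lemma form1_ext (a b : eform V 1) :
  (forall j : 'I_(\dim {:V}), a [tuple e`_j] = b [tuple e`_j]) -> a = b.
Proof.
move=> ab; apply/eqP; rewrite -subr_eq0; apply/eqP/form_basis0 => v ve.
have -> : v = [tuple thead v].
  by apply: eq_from_tnth => i; rewrite !ord1 tnth0.
have /tnthP[j ->] : thead v \in e by apply/ve/mem_tnth.
rewrite (tnth_nth 0) formDE ab -formDE subrr.
by [].
Qed.

Lemma dualbE i X : dualb i [tuple X] = coord e i X.
Proof. by []. Qed.

Lemma dualb_basis (i j : 'I_(\dim {:V})) :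
  dualb j [tuple e`_i] = (i == j)%:R :> R.
Proof. by rewrite dualbE coord_free //; exact: basis_free (vbasisP _). Qed.

Lemma form1_dualb (a : eform V 1) :
  a = \sum_(j < \dim {:V}) a [tuple e`_j] *: dualb j.
Proof.
apply: form1_ext => i; rewrite form_sumE (bigD1 i) //= big1 => [|j ji].
  by rewrite formZE dualb_basis (eqxx i) mulr1 addr0.
by rewrite formZE dualb_basis [i == j]eq_sym (negPf ji) mulr0.
Qed.

Lemma form1_sum I (r : seq I) (c : I -> R) (E : I -> V) (a : eform V 1) :
  a [tuple \sum_(i <- r) c i *: E i] = \sum_(i <- r) c i * a [tuple E i] :> R.
Proof.
have aE X : a [tuple X] = iprod X a [tuple] :> R.
  by rewrite iprodE mul1r; congr (a _); apply: val_inj.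
by rewrite aE iprod_suml form_sumE; apply: eq_bigr => i _; rewrite formZE aE.
Qed.

(** This is the degree operator. Contracting with [X] yields one copy of [iprod X u] plus the same
    sum for [iprod X u], to which induction applies. *)
Lemma sum_wedge_dualb k (u : eform V k.+1) :
  \sum_j wedge (dualb j) (iprod e`_j u) = k.+1%:R *: u :> eform V k.+1.
Proof.
elim: k u => [|k IHk] u.
  apply: formP => v; rewrite form_sumE [u in RHS]form1_dualb formZE mul1r.
  rewrite form_sumE.
  apply: eq_bigr => j _; rewrite (wedge0r _ _ (v' := v)) // formZE.
  by congr (_ * _); rewrite iprodE mul1r; congr (u _); apply: val_inj.
apply: form_iprod_inj => X; rewrite linear_sum linearZ /=.
have XE : \sum_j dualb j [tuple X] *: iprod e`_j u = iprod X u.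
  by rewrite -iprod_suml -(coord_vbasis (memvf X)).
rewrite (eq_bigr (fun j => dualb j [tuple X] *: iprod e`_j u +
    wedge (dualb j) (iprod e`_j (iprod X u)))) => [|j _].
  by rewrite big_split /= XE IHk -[k.+2]add1n natrD scalerDl scale1r.
by rewrite iprod_wedge1 iprodC linearN /= opprK.
Qed.

Lemma iprodNl k X (w : eform V k.+1) : iprod (- X) w = - iprod X w.
Proof.
have iprod0l : iprod 0 w = 0.
  by have := iprod_suml ([::] : seq nat) (fun=> 0) (fun=> 0) w;
    rewrite !big_nil.
by have := iprodPl (-1) X 0 w; rewrite !scaleN1r iprod0l !addr0.
Qed.

Lemma iprod_iprodE (Om : eform V 2) X Y :
  iprod X Om [tuple Y] = 2%:R * Om [tuple X; Y].
Proof. by rewrite iprodE; congr (_ * Om _); apply: val_inj. Qed.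

Lemma form2C (Om : eform V 2) X Y : Om [tuple X; Y] = - Om [tuple Y; X].
Proof.
have := form_tperm Om [tuple Y; X] (i := ord0) (j := ord_max) isT.
move=> <-; congr (Om _); apply: eq_from_tnth => -[[|[|//]] i2];
  by rewrite tnth_mktuple permE.
Qed.

(** Used with the inverse of [Gamma], to carry [Om] over to a bivector. *)
Lemma pullback_is_form (W : lmodType R) (f : W -> V) k (w : eform V k) :
  linear f -> (fun v => w (pullback_tuple f v)) \in is_form (k := k).
Proof.
move=> fl; have setE v i x : pullback_tuple f (set_tnth v i x) =
    set_tnth (pullback_tuple f v) i (f x) :> k.-tuple V.
  apply: eq_from_tnth => j; rewrite tnth_map !tnth_mktuple tnth_map.
  by case: eqP.
apply/asboolP; split=> [v i a x y|v i j ij vij].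
  by rewrite !setE fl form_multilinear.
have wa := form_alternating w; apply: (wa _ i j ij).
by rewrite !tnth_map vij.
Qed.

Section Symplectic.
Variables (Om : eform V 2) (Om_symplectic : symplectic Om).

Lemma Gamma_inj X Y : Gamma Om X = Gamma Om Y -> X = Y.
Proof.
move=> GXY; apply/eqP; rewrite -subr_eq0; apply/eqP/Om_symplectic => Z.
have : 2%:R * Om [tuple X - Y; Z] = 0 :> R.
  rewrite -iprod_iprodE -[X]scale1r iprodPl iprodNl -!/(Gamma Om _) GXY.
  by rewrite scale1r subrr.
by move/eqP; rewrite mulf_eq0 pnatr_eq0 => /eqP.
Qed.

(** A covector is recorded by its values on the basis; [Gamma] then becomes an injective linear map
    between spaces of equal finite dimension, and rank-nullity applies. *)
Lemma Gamma_surj (a : eform V 1) : exists X, Gamma Om X = a.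
Proof.
pose g X : 'rV[R]_(\dim {:V}) := \row_j Gamma Om X [tuple e`_j].
have gl : linear g.
  by move=> c X Y; apply/rowP => j; rewrite !mxE /Gamma iprodPl.
pose gL := GRing.isLinear.Build R V 'rV[R]_(\dim {:V}) *:%R g gl.
pose G : {linear V -> 'rV[R]_(\dim {:V})} := HB.pack g gL.
pose h := linfun G.
have hE X : h X = g X by rewrite lfunE.
have g_inj X Y : g X = g Y -> X = Y.
  move=> gXY; apply: Gamma_inj; apply: form1_ext => j.
  by have /rowP/(_ j) := gXY; rewrite !mxE.
have ker0 : lker h = 0%VS.
  by apply/eqP/lker0P => X Y; rewrite !hE => /g_inj.
have full : limg h = fullv.
  have := limg_ker_dim h fullv; rewrite ker0 capv0 dimv0 add0n => kd.
  apply/eqP; rewrite eqEdim subvf kd dimvf; apply: eq_leq; apply: mul1n.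
have : \row_j a [tuple e`_j] \in limg h by rewrite full memvf.
case/memv_imgP => X _ /rowP aX; exists X; apply: form1_ext => j.
by have := aX j; rewrite hE !mxE.
Qed.

End Symplectic.
End Duality.

(** * The operator bot and the Hitchin endomorphism *)

Section Contraction.
Variables (R : realType) (V : vectType R) (Om : eform V 2).
Hypothesis Om_symplectic : symplectic Om.
Local Notation e := (vbasis {:V}).

Definition Gamma_inv (a : eform V 1) : V :=
  sval (cid (Gamma_surj Om_symplectic a)).

Lemma Gamma_invK a : Gamma Om (Gamma_inv a) = a.
Proof. exact: svalP (cid (Gamma_surj Om_symplectic a)). Qed.

Lemma GammaK X : Gamma_inv (Gamma Om X) = X.
Proof. by apply: (Gamma_inj Om_symplectic); rewrite Gamma_invK. Qed.

Lemma Gamma_inv_linear : linear Gamma_inv.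
Proof.
move=> c a b; apply: (Gamma_inj Om_symplectic).
by rewrite Gamma_invK /Gamma iprodPl -!/(Gamma _ _) !Gamma_invK.
Qed.

Lemma XOmegaE a b :
  XOmega Om [tuple a; b] = Om [tuple Gamma_inv a; Gamma_inv b].
Proof.
pose B0 := Form (pullback_is_form Om Gamma_inv_linear).
have B0P v : B0 (pullback_tuple (Gamma Om) v) = Om v.
  rewrite /B0 /form_fun; congr (Om _); apply: eq_from_tnth => i.
  by rewrite !tnth_map GammaK.
(* The witness [B0] rules out the default value 0 of [xget]. *)
have XP : forall v, XOmega Om (pullback_tuple (Gamma Om) v) = Om v.
  by rewrite /XOmega; case: xgetP => [B _ //|/(_ B0)]; case.
rewrite -XP; congr (XOmega Om _); apply: val_inj => /=.
by rewrite !Gamma_invK.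
Qed.

Local Notation f j := (Gamma_inv (dualb j)).

(** The coefficient of [XOmega Om] at [(i, j)] is [Om(f_i, f_j) = e^i(f_j) / 2], so summing over [i]
    reassembles [f_j]. *)
Lemma botE k (w : eform V k.+2) :
  bot Om w = 2^-1 *: \sum_(j < \dim {:V}) iprod e`_j (iprod (f j) w).
Proof.
rewrite /bot /Defs.contract exchange_big /= scaler_sumr; apply: eq_bigr => j _.
rewrite [X in iprod X w](coord_vbasis (memvf (f j))) iprod_suml iprod_sumr.
rewrite scaler_sumr; apply: eq_bigr => i _; rewrite XOmegaE scalerA.
congr (_ *: _); have := iprod_iprodE Om (f i) (f j).
rewrite -/(Gamma Om _) Gamma_invK dualbE => ->.
by rewrite mulKf // pnatr_eq0.
Qed.

(** After applying [Gamma] this is the expansion of [Gamma Om X] in the dual basis; the sign is the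
    skew symmetry of [Om]. *)
Lemma Gamma_invE X : \sum_(j < \dim {:V}) Gamma Om e`_j [tuple X] *: f j = - X.
Proof.
apply: (Gamma_inj Om_symplectic); rewrite [LHS]iprod_suml.
rewrite (eq_bigr (fun j : 'I_(\dim {:V}) =>
    - (Gamma Om X [tuple e`_j] *: dualb j))) => [|j _].
  by rewrite sumrN -form1_dualb [RHS]iprodNl.
rewrite -/(Gamma Om _) Gamma_invK -scaleNr !iprod_iprodE form2C mulrN.
by [].
Qed.

(** Expanding each [Gamma Om e_j] in the dual basis and using [Gamma_invE] turns the sum into minus
    the degree operator. *)
Lemma sum_wedge_Gamma k (u : eform V k.+1) :
  \sum_(j < \dim {:V}) wedge (Gamma Om e`_j) (iprod (f j) u) =
  - (k.+1%:R *: u) :> eform V k.+1.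
Proof.
rewrite -sum_wedge_dualb -sumrN.
under eq_bigr => j _ do rewrite [Gamma Om _]form1_dualb wedge_suml.
rewrite exchange_big /=; apply: eq_bigr => j _.
transitivity (wedge (dualb j) (iprod (- e`_j) u)); last first.
  by rewrite iprodNl linearN.
rewrite -Gamma_invE iprod_suml linear_sum.
by apply: eq_bigr => i _; rewrite linearZ.
Qed.

(** * The commutation relation in dimension 6 *)

Hypothesis dimV : \dim {:V} = 6%N.

Lemma sum_dualb : \sum_(j < \dim {:V}) dualb j [tuple e`_j] = 6%:R :> R.
Proof.
rewrite (eq_bigr (fun=> 1 : R)) => [|j _].
  by rewrite sumr_const card_ord dimV.
by rewrite dualb_basis (eqxx j).
Qed.

Lemma bot_wedge k (u : eform V k.+2) :
  bot Om (wedge Om u : eform V k.+4) =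
  wedge Om (bot Om u) + (3%:R - k.+2%:R) *: u :> eform V k.+2.
Proof.
rewrite !botE linearZ /=.
pose S1 j := wedge (dualb j) (iprod e`_j u) : eform V k.+2.
pose S2 (j : 'I_(\dim {:V})) :=
  wedge (Gamma Om e`_j) (iprod (f j) u) : eform V k.+2.
pose S3 (j : 'I_(\dim {:V})) :=
  wedge Om (iprod e`_j (iprod (f j) u)) : eform V k.+2.
(* The four sums are [6 u], minus the degree times [u], the same again, and twice [Om /\ bot u];
   halving gives [3 - (k + 2)]. *)
rewrite (eq_bigr (fun j => dualb j [tuple e`_j] *: u - S1 j + S2 j + S3 j)).
  rewrite !big_split /= sumrN -scaler_suml sum_dualb.
  rewrite sum_wedge_dualb sum_wedge_Gamma addrC scalerDr.
  congr (_ + _); first by congr (_ *: _); rewrite linear_sum.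
  rewrite -!scaleNr -!scalerDl scalerA; congr (_ *: _).
  by field.
move=> j _; rewrite iprod_wedge2 linearD /= iprod_wedge2 addrA.
by rewrite -/(Gamma Om (f j)) Gamma_invK iprod_wedge1.
Qed.

(** The degree 0 case of the commutation relation, outside the range of [bot_wedge]. *)
Lemma bot_Om : bot Om Om [tuple] = 3%:R :> R.
Proof.
rewrite botE formZE form_sumE.
rewrite (eq_bigr (fun j => dualb j [tuple e`_j] : R)) => [|j _].
  by rewrite sum_dualb; field.
rewrite -/(Gamma Om _) Gamma_invK iprodE mul1r.
by congr (dualb j _); apply: val_inj.
Qed.

Lemma wedge_form0 (a : eform V 2) (c : eform V 0) :
  wedge a c = c [tuple] *: a :> eform V 2.
Proof. by apply: formP => v; rewrite (wedge0r _ _ (v' := v)) // formZE. Qed.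

Lemma bot0 k : bot Om (0 : eform V k.+2) = 0.
Proof. by rewrite botE big1 ?scaler0 // => j _; rewrite !linear0. Qed.

(* [bot (Om /\ t) = Om /\ bot t - 3 t], and the 8-form [Om /\ t] vanishes. *)
Lemma wedge_bot6 (t : eform V 6) :
  wedge Om (bot Om t) = 3%:R *: t :> eform V 6.
Proof.
have Ot0 : wedge Om t = 0 :> eform V 8 by apply: form_gt_dim0; rewrite dimV.
have := bot_wedge t; rewrite Ot0 bot0 => /esym/eqP.
rewrite addr_eq0 => /eqP ->; rewrite -scaleNr; congr (_ *: _); ring.
Qed.

(** * Powers of [Om] and forms of top degree *)

Let Om2 : eform V 4 := wedge Om Om.
(** Bracketed to the right, unlike in [theta], so that [bot_wedge] applies. *)
Let Om3 : eform V 6 := wedge Om Om2.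

Lemma bot_Om2 : bot Om Om2 = 4%:R *: Om.
Proof.
rewrite /Om2 (bot_wedge Om) wedge_form0 bot_Om -scalerDl; congr (_ *: _); ring.
Qed.

Lemma bot_Om3 : bot Om Om3 = 3%:R *: Om2.
Proof.
rewrite /Om3 (bot_wedge Om2) bot_Om2 linearZ /= -scalerDl; congr (_ *: _); ring.
Qed.

(** If it were 0, applying [bot] repeatedly would kill [Om2], then [Om], and finally the constant
    3. *)
Lemma Om3_neq0 : Om3 != 0.
Proof.
apply/eqP => O0; have := bot_Om3; rewrite O0 bot0 => /esym/eqP.
rewrite scaler_eq0 pnatr_eq0 /= => /eqP O20; have := bot_Om2; rewrite O20 bot0.
move/esym/eqP; rewrite scaler_eq0 pnatr_eq0 /= => /eqP O10.
have := bot_Om; rewrite {2}O10 bot0 form0E => /eqP.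
by rewrite eq_sym pnatr_eq0.
Qed.

Lemma wedge_Om4 (s : eform V 4) :
  wedge Om s = (bot Om (bot Om s) [tuple] / 12%:R) *: Om3 :> eform V 6.
Proof.
pose u : eform V 2 := bot Om s; pose c : R := bot Om u [tuple].
pose Ou : eform V 4 := wedge Om u.
(* From [3 T s = T (bot (T s)) = T (T u - s)]. *)
have E1 : 4%:R *: wedge Om s = wedge Om Ou :> eform V 6.
  have := wedge_bot6 (wedge Om s); rewrite (bot_wedge s) linearD linearZ /=.
  move=> /(canRL (addrK _)); rewrite -/u -/Ou => ->.
  rewrite -scalerBl; congr (_ *: _); ring.
(* Here [bot (T (T u)) = T (c Om + u) - T u], and the terms in [T u] cancel. *)
have E2 : 3%:R *: wedge Om Ou = c *: Om3 :> eform V 6.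
  have := wedge_bot6 (wedge Om Ou); rewrite (bot_wedge Ou) (bot_wedge u).
  rewrite wedge_form0 -/c !(wedgeDr, wedgeZr) => <-.
  rewrite -/Om2 -/Om3 -/Ou -addrA -scalerDl.
  have -> : (3 - 2 + (3 - 4) : R) = 0 by ring.
  by rewrite scale0r addr0.
have E3 : 12%:R *: wedge Om s = c *: Om3 :> eform V 6.
  by rewrite -E2 -E1 scalerA -natrM.
rewrite -/u -/c mulrC -scalerA -E3 scalerA mulVf ?scale1r //.
by rewrite pnatr_eq0.
Qed.

(** [wedge_bot6] writes [t] as [T (bot t) / 3], and [wedge_Om4] applies to the 4-form [bot t]. *)
Lemma form6_Om3 (t : eform V 6) : exists c, t = c *: Om3.
Proof.
exists (3%:R^-1 * (bot Om (bot Om (bot Om t)) [tuple] / 12%:R)).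
rewrite -scalerA -wedge_Om4 wedge_bot6 scalerA mulVf ?scale1r //.
by rewrite pnatr_eq0.
Qed.

Lemma thetaE : theta Om = - 6%:R^-1 *: Om3.
Proof.
rewrite /theta; congr (_ *: _); apply: formP => v.
rewrite (@wedgeC R V 4 2 (wedge Om Om) Om v v) // -signr_odd mul1r.
by [].
Qed.

Lemma theta_neq0 : theta Om != 0.
Proof.
by rewrite thetaE scaler_eq0 oppr_eq0 invr_eq0 pnatr_eq0 /= Om3_neq0.
Qed.

(** Existence of the endomorphism, so that [xget] does not return its default 0. *)
Lemma hitchinP (w : eform V 3) X :
  vtens (hitchin Om w X) (theta Om) = hitchin_A (wedge (iprod X w) w).
Proof.
pose c (t : eform V 6) : R := sval (cid (form6_Om3 t)).
have cE t : t = c t *: Om3 := svalP (cid (form6_Om3 t)).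
pose d t : R := - 6%:R * c t.
have dE t : t = d t *: theta Om.
  rewrite {1}[t]cE thetaE scalerA; congr (_ *: _); rewrite /d.
  by field.
have d_inj x y : x *: theta Om = y *: theta Om -> x = y.
  by move/eqP; rewrite -subr_eq0 -scalerBl scaler_eq0 (negPf theta_neq0) orbF
    subr_eq0 => /eqP.
pose phi Y : eform V 5 := wedge (iprod Y w) w.
(* The defining equation at the covector [e^j] forces the [j]-th coordinate of the image. *)
pose k Y := \sum_(j < \dim {:V}) d (wedge (dualb j) (phi Y)) *: e`_j.
have phiP x Y Z : phi (x *: Y + Z) = x *: phi Y + phi Z.
  by rewrite /phi iprodPl wedgePl.
(* [d] is a choice of coefficients; its linearity comes from their uniqueness, as [theta Om] is
   nonzero. *)
have kl : linear k.
  move=> x Y Z; rewrite /k scaler_sumr -big_split; apply: eq_bigr => j _ /=.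
  rewrite scalerA -scalerDl; congr (_ *: _); apply: d_inj.
  by rewrite scalerDl -scalerA -!dE phiP wedgePr.
pose kL := GRing.isLinear.Build R V V *:%R k kl.
pose K : {linear V -> V} := HB.pack k kL.
have KP : forall Y, vtens (linfun K Y) (theta Om) = hitchin_A (phi Y).
  move=> Y; apply/funext => a; rewrite /vtens /hitchin_A lfunE /=.
  rewrite [a in RHS]form1_dualb wedge_suml form1_sum scaler_suml.
  apply: eq_bigr => j _; rewrite mulrC -scalerA; congr (_ *: _); exact/esym.
have hP : forall Y, vtens (hitchin Om w Y) (theta Om) = hitchin_A (phi Y).
  by rewrite /hitchin; case: xgetP => [K' _ //|/(_ (linfun K))]; case.
exact: hP.
Qed.

Lemma Gamma_hitchin (w : eform V 3) X :
  Gamma Om X [tuple hitchin Om w X] =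
  bot Om (bot Om (wedge (iprod X w) (iprod X w) : eform V 4)) [tuple] / 2%:R
    :> R.
Proof.
pose phi : eform V 5 := wedge (iprod X w) w.
have Ophi0 : wedge Om phi = 0 :> eform V 7 by apply: form_gt_dim0; rewrite dimV.
have := iprod_wedge2 X Om phi; rewrite Ophi0 linear0 /phi iprod_wedge2 iprodK.
rewrite wedge0f add0r => /esym/eqP; rewrite addr_eq0 wedge_Om4 => /eqP E.
(* With [x] and [y] as set below, comparing coefficients of [Om3] gives [- x / 6 = - y / 12]. *)
have := congr1 (@^~ (Gamma Om X)) (hitchinP w X); rewrite /vtens /hitchin_A E.
rewrite thetaE scalerA -scaleNr => /eqP.
rewrite -subr_eq0 -scalerBl scaler_eq0 (negPf Om3_neq0) orbF subr_eq0 => /eqP.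
set x := Gamma _ _ _; set y := bot _ _ _ => xy.
lra.
Qed.

End Contraction.

Theorem proposition3p9 (R : realType) (V : vectType R)
    (dimV : \dim {:V} = 6%N)
    (Om : eform V 2) (Om_symplectic : symplectic Om)
    (w : eform V 3) (w_effective : wedge w Om = 0) (X : V) :
  lr_form Om w X = Om [tuple hitchin Om w X; X].
Proof.
have := Gamma_hitchin Om_symplectic dimV w X.
(* Now [2 Om(X, K X) = y / 2], and skew symmetry gives [Om(K X, X) = - y / 4]. *)
rewrite iprod_iprodE /lr_form form2C.
set x := Om _; set y := bot _ _ _ => xy.
lra.
Qed.
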